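(* For each integer $\ell\ge1$, let $L_\ell^{\mathrm{trk}}=\{w\in\{0,1\}^*\mid |w|_0=|w|_1=2\ell,\ \exists k\in\{1,\dots,\ell\}:\ \delta_{k,k}^{2\ell}(w)\in\{0101,1010,0110,1001\}\}$. Then $L_\ell^{\mathrm{trk}}$ is $2\ell$-uniform and $\mathcal{G}_{L_\ell^{\mathrm{trk}}}$ is exactly the class of $\ell$-track graphs.
   Context: $|w|_a$ is the number of occurrences of letter $a$ in $w$; a binary word is $k$-uniform if it has exactly $k$ occurrences of $0$ and of $1$. For a $2\ell$-uniform binary word $w$ and $k\in\{1,\dots,\ell\}$, $\delta_{k,k}^{2\ell}(w)$ is the word obtained from $w$ by deleting all occurrences of $0$ except the $(2k-1)$-st and $2k$-th, and all occurrences of $1$ except the $(2k-1)$-st and $2k$-th. For a word $w$ and distinct letters $a,b$, $h_{a,b}(w)$ is obtained by replacing $a$ by $0$, $b$ by $1$ and deleting all other letters. For $L\subseteq\{0,1\}^*$ closed under exchanging $0$ and $1$ and a word $w$ with letter set $V$, $G(L,w)$ is the graph on $V$ where distinct $u,v$ are adjacent iff $h_{u,v}(w)\in L$; $\mathcal{G}_L$ is the class of graphs isomorphic to some $G(L,w)$. A graph is an $\ell$-track graph if each vertex $v$ can be assigned closed real intervals $I_1(v),\dots,I_\ell(v)$ (interval $I_i(v)$ lying on track $i$) such that distinct $u,v$ are adjacent iff $I_i(u)\cap I_i(v)\neq\emptyset$ for some $i\in\{1,\dots,\ell\}$. *)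

(* Defs.v *)
From HB Require Import structures.
From mathcomp Require Import all_boot all_order all_algebra.
From mathcomp Require Import boolp classical_sets set_interval reals.

Set Implicit Arguments.
Unset Strict Implicit.
Unset Printing Implicit Defensive.

Local Open Scope classical_set_scope.

(* Binary words are [seq bool]: the letter 0 is [false], the letter 1 is [true]. *)
Notation bword := (seq bool).

Definition uniform_word (k : nat) (w : bword) : Prop :=
  count_mem false w = k /\ count_mem true w = k.

Definition uniform_lang (k : nat) (L : set bword) : Prop :=
  forall w, L w -> uniform_word k w.

Definition exchange_closed (L : set bword) : Prop :=
  forall w, L w -> L (map negb w).

Record sgraph := SGraph {
  vertex :> finType;
  edge : rel vertex;
  edge_sym : symmetric edge;
  edge_irrefl : irreflexive edge
}.

Definition isomorphic (G H : sgraph) : Prop :=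
  exists2 f : G -> H, bijective f & forall u v, edge (f u) (f v) = edge u v.

Definition h (A : eqType) (a b : A) (w : seq A) : bword :=
  [seq x == b | x <- w & (x == a) || (x == b)].

Lemma h_exchange (A : eqType) (a b : A) (w : seq A) :
  a != b -> h b a w = map negb (h a b w).
Proof.
move=> ab; rewrite /h -map_comp.
under eq_filter => x do rewrite orbC.
apply/eq_in_map => x; rewrite mem_filter => /andP[/orP[]/eqP-> _] /=.
  by rewrite eqxx (negbTE ab).
by rewrite eqxx eq_sym (negbTE ab).
Qed.

Section WordGraph.
Variables (L : set bword) (L_closed : exchange_closed L).
Variables (A : choiceType) (w : seq A).

(* [seq_sub w] is the type of letters occurring in [w]. *)
Definition word_edge : rel (seq_sub w) :=
  fun u v => (u != v) && (h (val u) (val v) w \in L).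

Lemma word_edge_sym : symmetric word_edge.
Proof.
suff imp u v : word_edge u v -> word_edge v u by move=> u v; apply/idP/idP; apply: imp.
case/andP=> uv /set_mem Lh; rewrite /word_edge eq_sym uv /=; apply/mem_set.
by rewrite h_exchange //; apply: L_closed.
Qed.

Lemma word_edge_irrefl : irreflexive word_edge.
Proof. by move=> u; rewrite /word_edge eqxx. Qed.

Definition word_graph : sgraph := SGraph word_edge_sym word_edge_irrefl.

End WordGraph.

Definition graph_class (L : set bword) (L_closed : exchange_closed L)
    (G : sgraph) : Prop :=
  exists (A : choiceType) (w : seq A), isomorphic G (word_graph L_closed w).

(* [count_mem c (take i.+1 w)], with [c] the letter at position [i], is the rank
   (from 1) of position [i] among the occurrences of [c] in [w]. *)
Definition delta (k : nat) (w : bword) : bword :=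
  [seq nth false w i | i <- iota 0 (size w) &
     count_mem (nth false w i) (take i.+1 w) \in [:: (2 * k).-1; 2 * k]].

Definition w0101 : bword := [:: false; true; false; true].
Definition w1010 : bword := [:: true; false; true; false].
Definition w0110 : bword := [:: false; true; true; false].
Definition w1001 : bword := [:: true; false; false; true].

Definition Ltrk (l : nat) : set bword :=
  [set w | [/\ count_mem false w = 2 * l, count_mem true w = 2 * l &
     exists k, 1 <= k <= l /\ delta k w \in [:: w0101; w1010; w0110; w1001]]].

Lemma count_negb (c : bool) (w : bword) :
  count_mem c (map negb w) = count_mem (~~ c) w.
Proof. by rewrite count_map; apply: eq_count => -[]; case: c. Qed.

Lemma delta_negb (k : nat) (w : bword) :
  delta k (map negb w) = map negb (delta k w).
Proof.
rewrite /delta -map_comp size_map.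
have nthN i : i \in iota 0 (size w) -> nth false (map negb w) i = ~~ nth false w i.
  by rewrite mem_iota /= => iw; rewrite (nth_map false).
have -> : [seq i <- iota 0 (size w) | count_mem (nth false (map negb w) i)
      (take i.+1 (map negb w)) \in [:: (2 * k).-1; 2 * k]] =
    [seq i <- iota 0 (size w) | count_mem (nth false w i) (take i.+1 w)
      \in [:: (2 * k).-1; 2 * k]].
  by apply: eq_in_filter => i /nthN ->; rewrite -map_take count_negb negbK.
by apply/eq_in_map => i; rewrite mem_filter => /andP[_ /nthN].
Qed.

Lemma Ltrk_closed (l : nat) : exchange_closed (Ltrk l).
Proof.
move=> w [w0 w1 [k [kl dk]]]; split; rewrite ?count_negb //.
exists k; split=> //; rewrite delta_negb.
by move: dk; rewrite !inE => /or4P[] /eqP->.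
Qed.

Definition closed_interval (R : realType) (I : set R) : Prop :=
  exists a b : R, (a <= b)%R /\ I = `[a, b].

Definition track_graph (R : realType) (l : nat) (G : sgraph) : Prop :=
  exists I : 'I_l -> G -> set R,
    (forall i v, closed_interval (I i v)) /\
    (forall u v : G, u != v ->
       (edge u v <-> exists i : 'I_l, I i u `&` I i v !=set0)).

(* Main.v *)
Require Import Defs.
From HB Require Import structures.
From mathcomp Require Import all_boot all_order all_algebra.
From mathcomp Require Import boolp classical_sets set_interval reals.
From mathcomp Require Import zify.

Set Implicit Arguments.
Unset Strict Implicit.
Unset Printing Implicit Defensive.

(* Read the (2k-1)-st and 2k-th occurrences of a letter as the endpoints of its
   k-th interval. The k-th intervals of u and v are disjoint exactly when some
   prefix contains 2k occurrences of one letter and at most 2k-2 of the other.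
   This criterion passes through h and delta, because the prefixes of h u v w
   and of delta k w are the images of the prefixes of w.
   From a word, intervals are read off as positions. Letters that do not occur
   2l times are isolated and get private points beyond the end of the word.
   From l tracks, each track is swept to write one letter per endpoint, and the
   resulting words are concatenated. *)

Import Order.TTheory Num.Theory.

(** * The prefixes of [delta k w] and their letter counts *)

Section Delta.
Implicit Types (k : nat) (c x : bool) (w d p q s t : bword).

(** Whether a position is kept depends only on the prefix ending there, so [delta k] can be computed
    from left to right. *)
Lemma delta_rcons k w x :
  delta k (rcons w x) =
  delta k w ++
    (if (count_mem x w).+1 \in [:: (2 * k).-1; 2 * k] then [:: x] else [::]).
Proof.
rewrite /delta size_rcons -[(size w).+1]addn1 iotaD filter_cat map_cat add0n.
congr (_ ++ _); last first.
  rewrite /= nth_rcons ltnn eqxx -(size_rcons w x) take_size -cats1 count_cat /=.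
  by rewrite eqxx addn0 addn1; case: ifP => //= _; rewrite nth_cat ltnn subnn.
have nthE i : i \in iota 0 (size w) -> nth false (rcons w x) i = nth false w i.
  by rewrite mem_iota nth_rcons /= add0n => ->.
rewrite (@eq_in_filter _ _ (fun i =>
  count_mem (nth false w i) (take i.+1 w) \in [:: (2 * k).-1; 2 * k])).
  by apply/eq_in_map => i; rewrite mem_filter => /andP[_ /nthE].
move=> i iw; rewrite nthE // -cats1 takel_cat //.
by move: iw; rewrite mem_iota.
Qed.

Lemma count_delta k c w : 0 < k ->
  count_mem c (delta k w) =
  ((2 * k).-1 <= count_mem c w) + (2 * k <= count_mem c w).
Proof.
move=> k0; elim/last_ind: w => [|w x IH]; first by rewrite /delta /=; lia.
rewrite delta_rcons count_cat IH -cats1 count_cat !inE /=.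
have [->|xc] := eqVneq x c.
  by case: ifP => /=; rewrite ?eqxx; lia.
by case: ifP => /=; rewrite ?(negbTE xc); lia.
Qed.

Lemma delta_cat k p s : exists t, delta k (p ++ s) = delta k p ++ t.
Proof.
elim/last_ind: s => [|s x [t IH]]; first by exists [::]; rewrite !cats0.
by rewrite -rcons_cat delta_rcons IH -catA; eexists.
Qed.

(** Appending one letter to [w] lengthens [delta k w] by at most one, so the images of the prefixes
    of [w] run through all prefixes of the image. *)
Lemma delta_prefix_inv k w q t : delta k w = q ++ t ->
  exists p s, w = p ++ s /\ delta k p = q.
Proof.
elim/last_ind: w t => [|w x IH] t.
  by case: q => // _; exists [::], [::].
case/lastP: t => [|t y].
  by rewrite cats0 => dq; exists (rcons w x), [::]; rewrite cats0.
rewrite delta_rcons.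
have ext t' : delta k w = q ++ t' ->
    exists p s, rcons w x = p ++ s /\ delta k p = q.
  by case/IH=> p [s [-> dp]]; exists p, (rcons s x); rewrite rcons_cat.
case: ifP => _; first by rewrite cats1 -rcons_cat => /rcons_inj[/ext].
by rewrite cats0 => /ext.
Qed.

Lemma two_letters c d : count_mem c d = 2 -> count_mem (~~ c) d = 0 ->
  d = [:: c; c].
Proof. by case: c; case: d => [|[] [|[] [|[] d]]] //=; lia. Qed.

(** Of the six words with two 0s and two 1s, only 0011 and 1100 are missing from the list. *)
Lemma uniform2_crossing d : uniform_word 2 d ->
  d \in [:: w0101; w1010; w0110; w1001] <->
  forall c, d <> [:: c; c; ~~ c; ~~ c].
Proof.
case=> d0 d1; split.
  by rewrite !inE => /or4P[] /eqP-> [].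
move=> nd; move: (nd true) (nd false) d0 d1.
by case: d {nd} => [|[] [|[] [|[] [|[] [|[] d]]]]] //=; lia.
Qed.

(** By [count_delta], a prefix with the stated counts has image [cc], and only two letters [~~ c]
    are left for the rest. Conversely, the prefix [cc] of the image lifts to a prefix of [w], whose
    counts are then forced. *)
Lemma delta_blocksP k c w : 0 < k ->
    2 * k <= count_mem c w -> 2 * k <= count_mem (~~ c) w ->
  delta k w = [:: c; c; ~~ c; ~~ c] <->
  exists p s, [/\ w = p ++ s, 2 * k <= count_mem c p
                & count_mem (~~ c) p < (2 * k).-1].
Proof.
move=> k0 kc kNc; split.
  move=> /(@delta_prefix_inv _ _ [:: c; c])[p [s [-> dp]]].
  exists p, s; split=> //.
    by have := count_delta c p k0; rewrite dp /= eqxx; lia.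
  by have := count_delta (~~ c) p k0; rewrite dp /=; case: c {kc kNc dp} => /=; lia.
case=> p [s [wE kp kNp]].
have := count_delta c w k0; have := count_delta (~~ c) w k0.
have := count_delta c p k0; have := count_delta (~~ c) p k0.
have [t] := delta_cat k p s; rewrite -wE => ->; rewrite !count_cat => e1 e2 e3 e4.
rewrite (@two_letters c (delta k p)); [|lia..].
by rewrite (@two_letters (~~ c) t) ?negbK //; lia.
Qed.

End Delta.

(** * The order of the [k]-th intervals of two letters of a word *)

Section WordIntervals.
Variable A : eqType.
Implicit Types (w p s : seq A) (u v : A) (k l : nat).

Lemma h_cat u v p s : h u v (p ++ s) = h u v p ++ h u v s.
Proof. by rewrite /h filter_cat map_cat. Qed.

Lemma h_prefix_inv u v w q t : h u v w = q ++ t ->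
  exists p s, w = p ++ s /\ h u v p = q.
Proof.
elim: w q => [|x w IH] q.
  by case: q => // _; exists [::], [::].
case: q => [|b q]; first by exists [::], (x :: w).
rewrite /h /=; case: ifP => /= xuv.
  by case=> <- /IH[p [s [-> <-]]]; exists (x :: p), s; rewrite /h /= xuv.
by move=> /(IH (b :: q))[p [s [-> <-]]]; exists (x :: p), s; rewrite /h /= xuv.
Qed.

Lemma count_h_false u v w : u != v -> count_mem false (h u v w) = count_mem u w.
Proof.
move=> uv; elim: w => //= x w IH; rewrite /h /=.
case: (eqVneq x u) => [->|xu]; first by rewrite /= (negbTE uv) /= -/(h u v w) IH.
by case xv: (x == v); rewrite /= ?xv -/(h u v w) IH.
Qed.

Lemma count_h_true u v w : count_mem true (h u v w) = count_mem v w.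
Proof.
elim: w => //= x w IH; rewrite /h /=.
have [->|xv] := eqVneq x v; first by rewrite orbT /= eqxx -/(h u v w) IH.
by case: ifP => _ /=; rewrite ?(negbTE xv) -/(h u v w) IH.
Qed.

(* The k-th interval of u ends before the k-th interval of v starts. *)
Definition precedes w k u v : Prop :=
  exists p s, [/\ w = p ++ s, 2 * k <= count_mem u p
                & count_mem v p < (2 * k).-1].

Lemma delta_h_crossingP w k u v : 0 < k -> u != v ->
    2 * k <= count_mem u w -> 2 * k <= count_mem v w ->
  delta k (h u v w) \in [:: w0101; w1010; w0110; w1001] <->
  ~ precedes w k u v /\ ~ precedes w k v u.
Proof.
move=> k0 uv ku kv.
have cf p : count_mem false (h u v p) = count_mem u p by exact: count_h_false.
have ct p : count_mem true (h u v p) = count_mem v p by exact: count_h_true.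
(* The letter [c] names the one whose interval comes first, so 0011 and 1100 are treated
   together. *)
have blockP (c : bool) (x := if c then v else u) (y := if c then u else v) :
    delta k (h u v w) = [:: c; c; ~~ c; ~~ c] <-> precedes w k x y.
  have cx p : count_mem c (h u v p) = count_mem x p by rewrite /x; case: c {x y}.
  have cy p : count_mem (~~ c) (h u v p) = count_mem y p by rewrite /y; case: c {x y cx}.
  rewrite delta_blocksP //; first last.
  - by rewrite cy /y; case: ifP.
  - by rewrite cx /x; case: ifP.
  split=> -[p [s [wE]]].
    case/h_prefix_inv: wE => p' [s' [-> <-]]; rewrite cx cy => *.
    by exists p', s'.
  by move=> *; exists (h u v p), (h u v s); rewrite wE h_cat cx cy.
rewrite uniform2_crossing; last first.
  by split; rewrite count_delta // (cf, ct); lia.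
split=> [nb|[nuv nvu] [] /blockP //].
by split=> [/(blockP false)/nb|/(blockP true)/nb].
Qed.

Lemma h_LtrkP w l u v : u != v ->
    count_mem u w = 2 * l -> count_mem v w = 2 * l ->
  Ltrk l (h u v w) <->
  exists i : 'I_l, ~ precedes w i.+1 u v /\ ~ precedes w i.+1 v u.
Proof.
move=> uv cu cv; split.
  case=> _ _ [[|k] [/andP[// k0 kl]]] /delta_h_crossingP.
  by case=> // [||nuv nvu]; [lia|lia|exists (Ordinal kl)].
case=> i np; split; [by rewrite count_h_false|by rewrite count_h_true|].
exists i.+1; split; first exact: ltn_ord.
by apply/delta_h_crossingP => //; have := ltn_ord i; lia.
Qed.

(** The length of the shortest prefix with [j] occurrences of [v], hence for [0 < j] the position
    counted from 1; it is [(size w).+1] if there is no such prefix. *)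
Definition occ w j v : nat :=
  find (fun i => j <= count_mem v (take i w)) (iota 0 (size w).+1).

Lemma occ_le_size w j v : occ w j v <= (size w).+1.
Proof. by rewrite -[X in _ <= X](size_iota 0) find_size. Qed.

Lemma count_take_mono w v i j :
  i <= j -> count_mem v (take i w) <= count_mem v (take j w).
Proof.
move=> ij; rewrite -(subnKC ij) takeD count_cat; exact: leq_addr.
Qed.

(** Prefix counts are monotone, so the first prefix that reaches [j] is a threshold. *)
Lemma occP w j v i : j <= count_mem v w ->
  (occ w j v <= i) = (j <= count_mem v (take i w)).
Proof.
move=> jv; set a := fun i => j <= count_mem v (take i w).
have hasa : has a (iota 0 (size w).+1).
  by apply/hasP; exists (size w); rewrite ?mem_iota ?add0n ?leqnn // /a take_size.
have lt_occ : occ w j v < (size w).+1.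
  by move: hasa; rewrite has_find size_iota.
apply/idP/idP => [le_i|ji].
  apply: leq_trans (count_take_mono w v le_i).
  by have := nth_find 0 hasa; rewrite nth_iota.
rewrite leqNgt; apply/negP => lt_i.
have := before_find 0 lt_i; rewrite nth_iota ?add0n /a ?ji //.
exact: ltn_trans lt_i lt_occ.
Qed.

Lemma occ_mono w v j1 j2 : j1 <= j2 <= count_mem v w ->
  occ w j1 v <= occ w j2 v.
Proof.
case/andP=> j12 j2v; rewrite occP; last exact: leq_trans j2v.
by apply: leq_trans j12 _; rewrite -occP.
Qed.

Lemma precedes_occ w k u v :
    2 * k <= count_mem u w -> 2 * k <= count_mem v w ->
  precedes w k u v <-> occ w (2 * k) u < occ w (2 * k).-1 v.
Proof.
move=> ku kv; have kv' : (2 * k).-1 <= count_mem v w by lia.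
split.
  case=> p [s [wE up vp]].
  have pE : take (size p) w = p by rewrite wE take_size_cat.
  apply: (@leq_ltn_trans (size p)); first by rewrite occP ?pE.
  by rewrite ltnNge occP // pE -ltnNge.
(* Cut right after the right endpoint of [u]. *)
move=> lt_uv; exists (take (occ w (2 * k) u) w), (drop (occ w (2 * k) u) w).
by rewrite cat_take_drop -occP // ltnNge -occP // -ltnNge.
Qed.

End WordIntervals.

(** * From words to tracks *)

Lemma itv_meetP (R : realType) (a b c d : R) : (a <= b)%R -> (c <= d)%R ->
  (`[a, b] `&` `[c, d] !=set0)%classic <-> ~ (b < c)%R /\ ~ (d < a)%R.
Proof.
move=> ab cd; split.
  case=> x [] /=; rewrite !in_itv /= => /andP[ax xb] /andP[cx xd].
  by split; apply/negP; rewrite -leNgt; [exact: le_trans cx xb|exact: le_trans ax xd].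
case=> /negP; rewrite -leNgt => cb /negP; rewrite -leNgt => ad.
(* The larger left endpoint lies in both intervals. *)
by exists (Num.max a c); split; rewrite /= in_itv /= le_max ge_max !lexx ?orbT ?ab ?cb ?ad ?cd.
Qed.

Lemma word_graph_track (R : realType) (l : nat) (G : sgraph) :
  graph_class (@Ltrk_closed l) G -> track_graph R l G.
Proof.
case=> A [w [f f_bij fE]].
pose x v := val (f v).
pose good v := count_mem (x v) w == 2 * l.
(* Values of [occ] are at most [(size w).+1], so these points lie strictly beyond them; the index
   keeps them distinct. *)
pose junk v := (size w).+2 + index (x v) w.
pose lo (i : 'I_l) v := if good v then occ w (2 * i.+1).-1 (x v) else junk v.
pose hi (i : 'I_l) v := if good v then occ w (2 * i.+1) (x v) else junk v.
have lohi i v : lo i v <= hi i v.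
  rewrite /lo /hi; case: ifP => // /eqP cv; apply: occ_mono; rewrite leq_pred cv.
  by have := ltn_ord i; lia.
have xw v : x v \in w by exact: ssvalP.
exists (fun i v => `[((lo i v)%:R)%R, ((hi i v)%:R)%R]%classic); split.
  by move=> i v; exists ((lo i v)%:R)%R, ((hi i v)%:R)%R; split=> //; rewrite ler_nat.
move=> u v uv.
have fuv : f u != f v by rewrite (inj_eq (bij_inj f_bij)).
have xuv : x u != x v by rewrite (inj_eq val_inj).
have -> : edge u v <-> Ltrk l (h (x u) (x v) w).
  by rewrite -fE /= /word_edge fuv /=; split=> [/set_mem|/mem_set].
have meetE i : (`[((lo i u)%:R)%R : R, ((hi i u)%:R)%R] `&`
      `[((lo i v)%:R)%R, ((hi i v)%:R)%R] !=set0)%classic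
    <-> ~ hi i u < lo i v /\ ~ hi i v < lo i u.
  by rewrite itv_meetP ?ler_nat // !ltr_nat.
have occ_small j y : occ w j y < (size w).+2 by exact: occ_le_size.
have [/andP[gu gv]|] := boolP (good u && good v).
  rewrite h_LtrkP; [|by []|exact/eqP|exact/eqP].
  have le2 (i : 'I_l) : 2 * i.+1 <= 2 * l by have := ltn_ord i; lia.
  have preE (i : 'I_l) y z : good y -> good z ->
      precedes w i.+1 (x y) (x z) <-> hi i y < lo i z.
    by move=> gy gz; rewrite /hi /lo gy gz precedes_occ ?(eqP gy) ?(eqP gz) ?le2.
  by split=> -[i ni]; exists i; move: ni; rewrite meetE !preE.
(* A letter with the wrong count violates the uniformity required by [Ltrk l], so there is no edge;
   it remains to see that the intervals never meet. *)
rewrite negb_and => bad; split.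
  case; rewrite count_h_false // count_h_true => /eqP gu /eqP gv _.
  by move: bad; rewrite /good gu gv.
case=> i /meetE; rewrite /hi /lo.
have idx : index (x u) w != index (x v) w.
  by apply: contra xuv => /eqP e; rewrite -(nth_index (x u) (xw u)) e nth_index.
have := occ_small (2 * i.+1) (x u); have := occ_small (2 * i.+1).-1 (x u).
have := occ_small (2 * i.+1) (x v); have := occ_small (2 * i.+1).-1 (x v).
by rewrite /junk; move: bad idx; case: (good u); case: (good v) => //=; lia.
Qed.

(** * From tracks to words *)

Lemma precedes_cat (A : eqType) (s1 s2 s3 : seq A) (k : nat) (u v : A) :
    count_mem u s1 = 2 * k -> count_mem v s1 = 2 * k -> count_mem v s2 = 2 ->
  precedes (s1 ++ s2 ++ s3) k.+1 u v <-> precedes s2 1 u v.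
Proof.
move=> u1 v1 v2; split; last first.
  case=> p [s [-> pu pv]]; exists (s1 ++ p), (s ++ s3).
  by rewrite -!catA !count_cat; split=> //; lia.
case=> p [s [wE pu pv]].
have pE : p = take (size p) (s1 ++ s2 ++ s3) by rewrite wE take_size_cat.
(* A cut inside [s1] sees at most [2 * k] letters [u], two too few; a cut beyond [s2] sees at least
   [2 * k + 2] letters [v], too many. Hence the cut falls inside [s2]. *)
move: pE pu pv; rewrite take_cat; case: ltnP => szp -> pu pv.
  move: pu; have : count_mem u (take (size p) s1) <= count_mem u s1.
    by rewrite -{2}(cat_take_drop (size p) s1) count_cat leq_addr.
  by lia.
move: pu pv; set j := size p - size s1; rewrite !count_cat take_cat.
case: ltnP => _; last by rewrite !count_cat; lia.
by move=> pu pv; exists (take j s2), (drop j s2); rewrite cat_take_drop; split=> //; lia.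
Qed.

Section Sweep.
Variables (R : realType) (V : finType) (a b : V -> R).
Hypothesis le_ab : forall v, (a v <= b v)%R.

Definition endpoint (x : V * bool) : R := if x.2 then b x.1 else a x.1.

(* At a common point left endpoints come first: closed intervals that touch
   must cross in the word. *)
Definition endpoint_le : rel (V * bool) := fun x y =>
  (endpoint x < endpoint y)%R || (endpoint x == endpoint y) && (x.2 ==> y.2).

Lemma endpoint_le_total : total endpoint_le.
Proof.
move=> x y; rewrite /endpoint_le.
by case: (ltgtP (endpoint x)) => //= _; case: x.2; case: y.2.
Qed.

Lemma endpoint_le_trans : transitive endpoint_le.
Proof.
move=> y x z /orP[xy|/andP[/eqP xy ixy]] /orP[yz|/andP[/eqP yz iyz]];
  rewrite /endpoint_le.
- by rewrite (lt_trans xy yz).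
- by rewrite -yz xy.
- by rewrite xy yz.
- rewrite xy yz eqxx ltxx /=; move: ixy iyz.
  by case: x.2; case: y.2; case: z.2.
Qed.

Definition endpoints : seq (V * bool) := sort endpoint_le (enum {: V * bool}).

Definition sweep : seq V := [seq x.1 | x <- endpoints].

Lemma mem_endpoints x : x \in endpoints.
Proof. by rewrite mem_sort mem_enum. Qed.

Lemma endpoints_uniq : uniq endpoints.
Proof. by rewrite sort_uniq enum_uniq. Qed.

(** [endpoint_le] is not antisymmetric: endpoints of the same side at the same point may be sorted
    either way. Only a failed comparison forces the order. *)
Lemma index_endpoints_lt x y :
  ~~ endpoint_le y x -> index x endpoints < index y endpoints.
Proof.
move=> nyx; rewrite ltnNge; apply: contra nyx => yx.
apply: (sorted_leq_index endpoint_le_trans) yx; rewrite ?mem_endpoints //.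
  by move=> z; have := endpoint_le_total z z; rewrite orbb.
exact: (sort_sorted endpoint_le_total).
Qed.

(** The letter [v] comes only from the pairs [(v, false)] and [(v, true)], each listed exactly
    once. *)
Lemma count_take_sweep v i :
  count_mem v (take i sweep) =
  (index (v, false) endpoints < i) + (index (v, true) endpoints < i).
Proof.
rewrite /sweep -map_take count_map.
rewrite -!in_take ?mem_endpoints // -!count_uniq_mem ?take_uniq ?endpoints_uniq //.
by elim: (take i _) => //= -[x c] t ->; rewrite !xpair_eqE; case: (x == v); case: c => /=; lia.
Qed.

Lemma count_sweep v : count_mem v sweep = 2.
Proof.
rewrite -(take_size sweep) count_take_sweep size_map.
by rewrite !index_mem !mem_endpoints.
Qed.

Lemma index_left_right v :
  index (v, false) endpoints < index (v, true) endpoints.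
Proof.
apply: index_endpoints_lt; rewrite /endpoint_le /endpoint /= andbF orbF -leNgt.
exact: le_ab.
Qed.

Lemma precedes_sweep u v : precedes sweep 1 u v <-> (b u < a v)%R.
Proof.
split.
  case=> p [s [wE pu pv]].
  have pE : p = take (size p) sweep by rewrite wE take_size_cat.
  move: pu pv; rewrite pE !count_take_sweep => pu pv.
  have lt_uv : index (u, true) endpoints < index (v, false) endpoints by lia.
  have := sorted_ltn_index endpoint_le_trans (sort_sorted endpoint_le_total _)
    _ _ (mem_endpoints _) (mem_endpoints _) lt_uv.
  (* Equality is excluded, since a right endpoint is not below a left endpoint at the same point. *)
  by rewrite /endpoint_le /endpoint /= andbF orbF.
(* Cut just before the first letter [v]. *)
move=> bu_av; set i := index (v, false) endpoints.
exists (take i sweep), (drop i sweep); rewrite cat_take_drop !count_take_sweep.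
have := index_left_right u; have := index_left_right v; rewrite -/i.
have : index (u, true) endpoints < i.
  apply: index_endpoints_lt; rewrite /endpoint_le /endpoint /= negb_or -leNgt ltW //=.
  by rewrite andbT gt_eqF.
by split=> //; lia.
Qed.

End Sweep.

Lemma track_word_graph (R : realType) (l : nat) (G : sgraph) : 1 <= l ->
  track_graph R l G -> graph_class (@Ltrk_closed l) G.
Proof.
move=> l_ge1 [I [Icl IE]].
have /choice[c /all_and2[le_c cE]] : forall iv : 'I_l * G, exists c : R * R,
    (c.1 <= c.2)%R /\ I iv.1 iv.2 = `[c.1, c.2]%classic.
  by case=> i v; have [a [b ?]] := Icl i v; exists (a, b).
pose W i := sweep (fun v => (c (i, v)).1) (fun v => (c (i, v)).2).
pose w := flatten [seq W i | i <- enum 'I_l].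
have countW v s : count_mem v (flatten [seq W i | i <- s]) = 2 * size s.
  by elim: s => //= i s IH; rewrite count_cat IH count_sweep; lia.
have countw v : count_mem v w = 2 * l by rewrite countW size_enum_ord.
(* Here [1 <= l] matters: every vertex must occur in [w] to be a vertex of the word graph. *)
have vw v : v \in w by rewrite -has_pred1 has_count countw; lia.
exists G, w, (fun v => SeqSub (vw v)).
  by exists val => // x; apply: val_inj.
move=> u v; rewrite /= /word_edge -(inj_eq val_inj) /=.
have [->|uv] /= := eqVneq u v; first by rewrite edge_irrefl.
have preE (i : 'I_l) x y :
    precedes w i.+1 x y <-> ((c (i, x)).2 < (c (i, y)).1)%R.
  (* The [i] blocks before [W i] contain each letter [2 * i] times, so the interval of rank [i.+1]
     is the one written by [W i]. *)
  have wE : w = flatten [seq W j | j <- take i (enum 'I_l)] ++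
                W i ++ flatten [seq W j | j <- drop i.+1 (enum 'I_l)].
    rewrite /w -{1}(cat_take_drop i (enum 'I_l)) map_cat flatten_cat.
    by rewrite (drop_nth i) ?size_enum_ord // nth_ord_enum.
  have szi : size (take i (enum 'I_l)) = i.
    by rewrite size_takel // size_enum_ord ltnW.
  rewrite wE precedes_cat ?countW ?szi ?count_sweep //.
  by apply: precedes_sweep => z; exact: (le_c (i, z)).
apply/idP/idP => [/set_mem|/IE]; rewrite ?h_LtrkP //.
  case=> i; rewrite !preE => np; apply/IE => //; exists i.
  by rewrite (cE (i, u)) (cE (i, v)) itv_meetP //; exact: le_c.
case=> // i; rewrite (cE (i, u)) (cE (i, v)) itv_meetP; [|exact: le_c..].
by move=> np; apply/mem_set/h_LtrkP => //; exists i; rewrite !preE.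
Qed.

Theorem theorem3 (R : realType) (l : nat) (l_ge1 : 1 <= l) :
  uniform_lang (2 * l) (Ltrk l) /\
  (forall G : sgraph, graph_class (@Ltrk_closed l) G <-> track_graph R l G).
Proof.
split=> [w [] //|G]; split; first exact: word_graph_track.
exact: track_word_graph.
Qed.
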